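(* For all $s\ge 2$, $$Q(x,y)=xe^{y(e^x-1)}-\int_0^x(1+sr)e^{y(e^r-1)}\,dr-\int_0^x\int_0^re^{y(e^{r-t}-1)}\left(ye^r\exp_{s-1}\!\left((e^t-1)e^{r-t}y\right)-s\cdot \exp_s\!\left((e^t-1)e^{r-t}y\right)\right)dt\,dr.$$
   Context: $\mathcal{P}_{n,k}$ is the set of partitions of $[n]=\{1,\dots,n\}$ into $k$ nonempty blocks. A partition with blocks $T_1,\dots,T_k$, ordered so that $\min T_1<\cdots<\min T_k$, is identified with its sequential form $\pi=\pi_1\cdots\pi_n$, where $i\in T_{\pi_i}$. An occurrence of $a(a+s)$ in $\pi$ is an index $i\in\{1,\dots,n-1\}$ with $\pi_{i+1}-\pi_i=s$. For fixed $s$, let $p_{n,k}$ be the total number of occurrences of $a(a+s)$ in all the members of $\mathcal{P}_{n,k}$, let $Q_k(x)=\sum_{n\ge 0}p_{n,k}\frac{x^n}{n!}$, and let $Q(x,y)=\sum_{k\ge s+1}Q_k(x)y^k$ (note $Q_k(x)=0$ for $0\le k\le s$). Also $\exp_m(x)=\sum_{j=0}^m\frac{x^j}{j!}$. The identity is one of formal power series in $x$ and $y$. *)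

(* Defs.v *)
From HB Require Import structures.
From mathcomp Require Import all_boot all_order all_algebra.
From mathcomp Require boolp.
From mathcomp Require Import mpoly.

Set Implicit Arguments.
Unset Strict Implicit.
Unset Printing Implicit Defensive.

Import Order.TTheory GRing.Theory Num.Theory.

Local Open Scope ring_scope.

(* Formal power series over rat in n commuting variables, given by their
   coefficients.  Multinomials provides polynomials only, so the Q-algebra
   structure is built here, by truncation to {mpoly rat[n]}. *)
Definition mfps (n : nat) : Type := 'X_{1..n} -> rat.

Definition mfps_zero n : mfps n := fun=> 0.
Definition mfps_one n : mfps n := fun m => (m == 0%MM)%:R.
Definition mfps_opp n (f : mfps n) : mfps n := fun m => - f m.
Definition mfps_add n (f g : mfps n) : mfps n := fun m => f m + g m.
Definition mfps_scale n (a : rat) (f : mfps n) : mfps n := fun m => a * f m.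

(* Every decomposition m = m1 + m2 has degrees at most mdeg m, so the sum
   ranges over all of them. *)
Definition mfps_mul n (f g : mfps n) : mfps n := fun m =>
  \sum_(k : 'X_{1..n < (mdeg m).+1, (mdeg m).+1} | m == (k.1 + k.2)%MM)
     f k.1 * g k.2.

Section Truncation.
Variable n : nat.
Implicit Types (f g h : mfps n) (m : 'X_{1..n}).

Definition mfps_trunc (d : nat) (f : mfps n) : {mpoly rat[n]} :=
  \sum_(k : 'X_{1..n < d}) f k *: 'X_[k].

Lemma mcoeff_mfps_trunc d f m :
  (mfps_trunc d f)@_m = if (mdeg m < d)%N then f m else 0.
Proof.
rewrite /mfps_trunc raddf_sum /=; case: ifP => [lt_md|ge_md].
  rewrite (bigD1 (BMultinom lt_md)) //= mcoeffZ mcoeffX eqxx mulr1.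
  rewrite big1 ?addr0 // => k neq_k; rewrite mcoeffZ mcoeffX.
  case: eqP => [eq_km|_]; last by rewrite mulr0.
  by case/eqP: neq_k; apply: val_inj.
rewrite big1 // => k _; rewrite mcoeffZ mcoeffX.
case: eqP => [eq_km|_]; last by rewrite mulr0.
by move: ge_md; rewrite -eq_km bmdeg.
Qed.

Lemma mcoeffM_low (p q p' q' : {mpoly rat[n]}) m :
    (forall k, (mdeg k <= mdeg m)%N -> p@_k = p'@_k) ->
    (forall k, (mdeg k <= mdeg m)%N -> q@_k = q'@_k) ->
  (p * q)@_m = (p' * q')@_m.
Proof.
move=> eq_p eq_q; rewrite !mcoeffM; apply: eq_bigr => k _.
by rewrite eq_p ?eq_q // -ltnS bmdeg.
Qed.

Lemma mfps_mulE d f g m : (mdeg m < d)%N ->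
  mfps_mul f g m = (mfps_trunc d f * mfps_trunc d g)@_m.
Proof.
move=> lt_md; rewrite mcoeffM; apply: eq_bigr => k _.
by rewrite !mcoeff_mfps_trunc !(leq_trans (bmdeg _)).
Qed.

Lemma mfps_addA : associative (@mfps_add n).
Proof. by move=> f g h; apply: boolp.funext => m; apply: addrA. Qed.

Lemma mfps_addC : commutative (@mfps_add n).
Proof. by move=> f g; apply: boolp.funext => m; apply: addrC. Qed.

Lemma mfps_add0 : left_id (@mfps_zero n) (@mfps_add n).
Proof. by move=> f; apply: boolp.funext => m; apply: add0r. Qed.

Lemma mfps_addN : left_inverse (@mfps_zero n) (@mfps_opp n) (@mfps_add n).
Proof. by move=> f; apply: boolp.funext => m; apply: addNr. Qed.

Lemma mfps_mulA : associative (@mfps_mul n).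
Proof.
move=> f g h; apply: boolp.funext => m.
rewrite !(mfps_mulE _ _ (ltnSn (mdeg m))); set d := (mdeg m).+1.
transitivity
  ((mfps_trunc d f * (mfps_trunc d g * mfps_trunc d h))@_m).
  apply: mcoeffM_low => // k le_km.
  by rewrite mcoeff_mfps_trunc ltnS le_km (@mfps_mulE d).
rewrite mulrA; apply: mcoeffM_low => // k le_km.
by rewrite mcoeff_mfps_trunc ltnS le_km (@mfps_mulE d).
Qed.

Lemma mfps_mulC : commutative (@mfps_mul n).
Proof.
move=> f g; apply: boolp.funext => m.
by rewrite !(mfps_mulE _ _ (ltnSn (mdeg m))) mulrC.
Qed.

Lemma mfps_mul1 : left_id (@mfps_one n) (@mfps_mul n).
Proof.
move=> f; apply: boolp.funext => m.
rewrite (mfps_mulE _ _ (ltnSn (mdeg m))); set d := (mdeg m).+1.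
transitivity ((1 * mfps_trunc d f)@_m); last first.
  by rewrite mul1r mcoeff_mfps_trunc ltnSn.
apply: mcoeffM_low => // k le_km.
by rewrite mcoeff_mfps_trunc ltnS le_km mcoeff1 /mfps_one.
Qed.

Lemma mfps_mulDl : left_distributive (@mfps_mul n) (@mfps_add n).
Proof.
move=> f g h; apply: boolp.funext => m.
rewrite /mfps_mul /mfps_add -big_split /=.
by apply: eq_bigr => k _; rewrite mulrDl.
Qed.

Lemma mfps_one_neq0 : @mfps_one n <> @mfps_zero n.
Proof.
by move=> /(congr1 (fun f => f 0%MM)) /eqP; rewrite /mfps_one eqxx.
Qed.

Lemma mfps_scaleA a b f :
  mfps_scale a (mfps_scale b f) = mfps_scale (a * b) f.
Proof. by apply: boolp.funext => m; apply: mulrA. Qed.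

Lemma mfps_scale1 : left_id 1 (@mfps_scale n).
Proof. by move=> f; apply: boolp.funext => m; apply: mul1r. Qed.

Lemma mfps_scaleDr : right_distributive (@mfps_scale n) (@mfps_add n).
Proof. by move=> a f g; apply: boolp.funext => m; apply: mulrDr. Qed.

Lemma mfps_scaleDl f :
  {morph (@mfps_scale n)^~ f : a b / a + b >-> mfps_add a b}.
Proof. by move=> a b; apply: boolp.funext => m; apply: mulrDl. Qed.

Lemma mfps_scaleAl a f g :
  mfps_scale a (mfps_mul f g) = mfps_mul (mfps_scale a f) g.
Proof.
apply: boolp.funext => m; rewrite /mfps_scale /mfps_mul mulr_sumr.
by apply: eq_bigr => k _; rewrite mulrA.
Qed.

End Truncation.

HB.instance Definition _ n := boolp.gen_eqMixin (mfps n).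
HB.instance Definition _ n := boolp.gen_choiceMixin (mfps n).
HB.instance Definition _ n := GRing.isZmodule.Build (mfps n)
  (@mfps_addA n) (@mfps_addC n) (@mfps_add0 n) (@mfps_addN n).
HB.instance Definition _ n := GRing.Zmodule_isComNzRing.Build (mfps n)
  (@mfps_mulA n) (@mfps_mulC n) (@mfps_mul1 n) (@mfps_mulDl n)
  (introN eqP (@mfps_one_neq0 n)).
HB.instance Definition _ n := GRing.Zmodule_isLmodule.Build rat (mfps n)
  (@mfps_scaleA n) (@mfps_scale1 n) (@mfps_scaleDr n) (@mfps_scaleDl n).
HB.instance Definition _ n :=
  GRing.Lmodule_isLalgebra.Build rat (mfps n) (@mfps_scaleAl n).
HB.instance Definition _ n := GRing.Lalgebra_isComAlgebra.Build rat (mfps n).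

Definition mfps_var n (i : 'I_n) : mfps n := fun m => (m == U_(i)%MM)%:R.

(* exp_m(f) = \sum_(j <= m) f^j / j!. *)
Definition fexp_trunc n (m : nat) (f : mfps n) : mfps n :=
  \sum_(j < m.+1) (j`!%:R)^-1 *: f ^+ j.

(* exp(f) for f without constant term: f^j then has no monomial of degree
   less than j, so the coefficient of m in exp(f) only involves j <= mdeg m. *)
Definition fexp n (f : mfps n) : mfps n := fun m => fexp_trunc (mdeg m) f m.

(* Formal antiderivative in the i-th variable, vanishing at X_i = 0. *)
Definition fprim n (i : 'I_n) (f : mfps n) : mfps n := fun m =>
  if m i == 0%N then 0 else f (m - U_(i))%MM / (m i)%:R.

(* f with X_j substituted for X_i, where i != j: the coefficient of a monomial
   X_j^e M, with M free of X_i and X_j, collects those of X_i^a X_j^(e-a) M. *)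
Definition fsubst_var n (i j : 'I_n) (f : mfps n) : mfps n := fun m =>
  if m i == 0%N then \sum_(a < (m j).+1) f (m - U_(j) *+ a + U_(i) *+ a)%MM
  else 0.

(* The integral of f with respect to X_i from 0 to X_j. *)
Definition fint n (i j : 'I_n) (f : mfps n) : mfps n :=
  fsubst_var i j (fprim i f).

(* [n] is 'I_n, with i : 'I_n standing for i + 1. *)
Definition set_partitions (n k : nat) : {set {set {set 'I_n}}} :=
  [set P : {set {set 'I_n}} | partition P [set: 'I_n] & #|P| == k].

Definition block_min n (B : {set 'I_n}) : nat := \big[minn/n]_(i in B) i.

(* T_1, ..., T_k in increasing order of their minima. *)
Definition ordered_blocks n (P : {set {set 'I_n}}) : seq {set 'I_n} :=
  sort (fun A B => block_min A <= block_min B)%N (enum P).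

(* pi_1, ..., pi_n, where i belongs to T_(pi_i). *)
Definition sequential_form n (P : {set {set 'I_n}}) : seq nat :=
  [seq (index (pblock P i) (ordered_blocks P)).+1 | i <- enum 'I_n].

Definition occurrences (s : nat) (w : seq nat) : nat :=
  count (fun i => nth 0%N w i.+1 == nth 0%N w i + s)%N (iota 0 (size w).-1).

Definition total_occurrences (s n k : nat) : nat :=
  \sum_(P in set_partitions n k) occurrences s (sequential_form P).

(* All series live in Q[[x, y, r, t]], r and t being the integration
   variables; Q[[x, y]] is its subring of series free of r and t. *)
Definition ix : 'I_4 := inord 0.
Definition iy : 'I_4 := inord 1.
Definition ir : 'I_4 := inord 2.
Definition it : 'I_4 := inord 3.

(* Q(x, y) = \sum_(k >= s + 1) \sum_(n >= 0) p_{n,k} x^n / n! y^k. *)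
Definition Qseries (s : nat) : mfps 4 := fun m =>
  if [&& (s < m iy)%N, m ir == 0%N & m it == 0%N]
  then (total_occurrences s (m ix) (m iy))%:R / ((m ix)`!)%:R else 0.

(* Main.v *)
Require Import Defs.
From mathcomp Require Import all_boot all_order all_algebra.
From mathcomp Require boolp.
From mathcomp Require Import mpoly.
From mathcomp Require Import ring zify.

(** Both sides of the identity are determined by the same linear recurrence.

    Write S(n,k) for the number of partitions of [n] into k blocks, that is, of
    restricted growth words of length n with largest letter k, and p(n,k) for
    the total number of occurrences.  Removing the last letter of a word, and
    counting separately the words whose last pair is an occurrence, gives
    [rgf_occ_rec]:
      p(n+2,k) = k p(n+1,k) + p(n+1,k-1) + [k > s] (S(n+1,k) - s S(n,k)),
    with p(0,k) = p(1,k) = 0.  The sequential form is a bijection from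
    partitions to restricted growth words ([total_occurrencesE]), so p is the
    coefficient array of Q.

    On the analytic side, let U = y (e^r - 1) and E = exp(U).  As x exp(y (e^x -
    1)) is the integral of D_r(r E) from 0 to x, the right-hand side is the
    integral from 0 to x of a single series Phi(r,y), and the claim is that
    Phi = \sum p(n+1,k) r^n/n! y^k.  The recurrence above is the differential
    equation
      (D_r - y D_y - y) Phi = D_r W - s W,    W = E - exp_s(U),
    because W = \sum_(k > s) S(n,k) r^n/n! y^k, and Phi vanishes at r = 0.
    The derivation D_r - y D_y kills y e^r and y e^(r-t), hence also the
    argument of exp_(s-1) and exp_s in the inner integrand I, and multiplies
    exp(y (e^(r-t) - 1)) by y.  So (D_r - y D_y - y) I = 0, and applying the
    operator to the integral of I from t = 0 to t = r leaves only the boundary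
    term I(t = r) = y e^r exp_(s-1)(U) - s exp_s(U).  This is [Phi_pde]; no
    integral is ever evaluated. *)

Set Implicit Arguments.
Unset Strict Implicit.
Unset Printing Implicit Defensive.

Import GRing.Theory Num.Theory.

(** * Restricted growth words *)

(** Restricted growth words of length n with set of letters {1, ..., k}, sorted
    by their last letter: either it already occurs in the rest of the word, or
    it is the letter k, occurring for the first time. *)
Fixpoint rgf (n k : nat) : seq (seq nat) :=
  match n, k with
  | 0, 0 => [:: [::]]
  | 0, _.+1 | _.+1, 0 => [::]
  | n'.+1, k'.+1 =>
      [seq rcons w a | w <- rgf n' k'.+1, a <- iota 1 k'.+1]
      ++ [seq rcons w k'.+1 | w <- rgf n' k']
  end.

Lemma rgfS n k : rgf n.+1 k.+1 =
  [seq rcons w a | w <- rgf n k.+1, a <- iota 1 k.+1]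
  ++ [seq rcons w k.+1 | w <- rgf n k].
Proof. by []. Qed.

(** Restricted growth, stated without reference to maxima of prefixes: a letter
    appears only once all smaller letters have appeared.  In this form it can
    be read off a partition whose blocks are ordered by their minima. *)
Definition is_rgf (n k : nat) (w : seq nat) :=
  [/\ size w = n,
      forall c, (c \in w) = (1 <= c <= k) &
      forall i c, i < n -> 1 <= c <= nth 0 w i -> c \in take i.+1 w].

(** A last letter a that is new must be the largest one: if k + 1 <> a
    occurred before, the growth condition would force a to occur earlier. *)
Lemma is_rgf_rcons n k w a :
  is_rgf n.+1 k.+1 (rcons w a) <->
  (is_rgf n k.+1 w /\ 1 <= a <= k.+1) \/ (is_rgf n k w /\ a = k.+1).
Proof.
split.
  case; rewrite size_rcons => -[sz_w] mem_w pre_w.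
  have a_bd : 1 <= a <= k.+1 by rewrite -mem_w mem_rcons inE eqxx.
  have pre i c : i < n -> 1 <= c <= nth 0 w i -> c \in take i.+1 w.
    move=> lt_in c_bd; have := pre_w i c (leqW lt_in).
    by rewrite nth_rcons sz_w lt_in -cats1 takel_cat ?sz_w //; apply.
  case: (boolP (a \in w)) => aw.
    left; split=> //; split=> // c; rewrite -mem_w mem_rcons inE.
    by case: eqP => // ->; rewrite aw.
  have def_a : a = k.+1.
    apply/eqP; apply: contraR aw => ne_ak.
    have : k.+1 \in rcons w a by rewrite mem_w; lia.
    rewrite mem_rcons inE eq_sym (negPf ne_ak) /= => /(nthP 0)[i lt_i def_k].
    have := pre i a; rewrite -sz_w def_k => /(_ lt_i a_bd) /mem_take.
    by [].
  right; split=> //; split=> // c.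
  have := mem_w c; rewrite mem_rcons inE; case: (c =P a) => [->|ne_ca] /=.
    by move=> _; rewrite (negPf aw) def_a; lia.
  by move=> ->; move: ne_ca; rewrite def_a; lia.
case=> [[[sz_w mem_w pre_w] a_bd]|[[sz_w mem_w pre_w] ->]].
  split=> [|c|i c]; first by rewrite size_rcons sz_w.
    by rewrite mem_rcons inE mem_w; case: eqP => // ->.
  rewrite nth_rcons sz_w ltnS leq_eqVlt => /orP[/eqP->|lt_in].
    rewrite ltnn eqxx take_oversize ?size_rcons ?sz_w // => c_bd.
    by rewrite mem_rcons inE mem_w; lia.
  by rewrite lt_in -cats1 takel_cat ?sz_w //; apply: pre_w.
split=> [|c|i c]; first by rewrite size_rcons sz_w.
  by rewrite mem_rcons inE mem_w; lia.
rewrite nth_rcons sz_w ltnS leq_eqVlt => /orP[/eqP->|lt_in].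
  rewrite ltnn eqxx take_oversize ?size_rcons ?sz_w // => c_bd.
  by rewrite mem_rcons inE mem_w; lia.
by rewrite lt_in -cats1 takel_cat ?sz_w //; apply: pre_w.
Qed.

Lemma mem_rgf n k w : w \in rgf n k <-> is_rgf n k w.
Proof.
elim: n k w => [|n IHn] [|k] w.
- rewrite inE; split=> [/eqP ->|[/size0nil -> _ _]] //.
  by split=> // c; rewrite in_nil; case: c.
- split=> // -[/size0nil -> mem_w _].
  by have := mem_w 1; rewrite in_nil.
- split=> //; case: w => [[]|a w [_ mem_w _]] //.
  by have := mem_w a; rewrite inE eqxx; lia.
- rewrite rgfS mem_cat; split.
    case/orP => [/allpairsPdep[v [a [/IHn rgf_v]]]|/mapP[v /IHn rgf_v ->]].
      rewrite mem_iota => a_bd ->; apply/is_rgf_rcons; left.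
      by split=> //; lia.
    by apply/is_rgf_rcons; right.
  case/lastP: w => [[]|v a /is_rgf_rcons[]] // [/IHn rgf_v].
    move=> a_bd; apply/orP; left; apply/allpairsPdep; exists v, a; split=> //.
    by rewrite mem_iota; lia.
  by move=> ->; apply/orP; right; apply: map_f.
Qed.

Lemma rgf_uniq n k : uniq (rgf n k).
Proof.
elim: n k => [|n IHn] [|k] //; rewrite rgfS cat_uniq; apply/and3P; split.
- apply: allpairs_uniq; rewrite ?iota_uniq //.
  by move=> [v a] [v' a'] /= _ _ /rcons_inj[-> ->].
- apply/hasPn => _ /mapP[v /mem_rgf[_ mem_v _] ->].
  apply/negP => /allpairsPdep[v' [a [/mem_rgf[_ mem_v' _] _ /rcons_inj[eq_v _]]]].
  by have := mem_v k.+1; rewrite eq_v mem_v'; lia.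
by rewrite map_inj_uniq // => v v' /rcons_inj[].
Qed.

Section Counting.
Variable s : nat.

Definition rgf_occ (n k : nat) : nat := \sum_(w <- rgf n k) occurrences s w.

Lemma occurrences_rcons w a :
  occurrences s (rcons w a) =
    occurrences s w + ((w != [::]) && (a == last 0 w + s)).
Proof.
rewrite /occurrences size_rcons /=; case: w => [|b w] //.
rewrite [size _]/= [_.-1]/= -[X in iota 0 X]addn1.
rewrite iotaD count_cat /= add0n addn0; congr (_ + _).
  apply: eq_in_count => i; rewrite mem_iota add0n => /= lt_iw.
  rewrite -rcons_cons !nth_rcons /=.
  by rewrite lt_iw (ltnS i) (ltnW lt_iw).
by rewrite -rcons_cons !nth_rcons /= ltnn eqxx ltnSn -last_nth.
Qed.

Lemma big_rgfS n k (F : seq nat -> nat) :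
  \sum_(w <- rgf n.+1 k.+1) F w =
    \sum_(w <- rgf n k.+1) \sum_(a <- iota 1 k.+1) F (rcons w a)
    + \sum_(w <- rgf n k) F (rcons w k.+1).
Proof. by rewrite rgfS big_cat big_allpairs_dep /= big_map. Qed.

Lemma size_rgfS n k :
  size (rgf n.+1 k.+1) = k.+1 * size (rgf n k.+1) + size (rgf n k).
Proof. by rewrite rgfS size_cat size_allpairs size_map /= size_iota mulnC. Qed.

Lemma rgf_neq0 n k w : w \in rgf n.+1 k -> w != [::].
Proof. by case/mem_rgf; case: w. Qed.

Hypothesis s_ge2 : 2 <= s.

Lemma sum_count (T : Type) (P : pred T) (r : seq T) :
  \sum_(a <- r) (P a : nat) = count P r.
Proof. by elim: r => [|a r IHr]; rewrite ?big_nil // big_cons IHr. Qed.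

Lemma sum_nat_seq_const (T : Type) (r : seq T) c :
  \sum_(a <- r) c = size r * c.
Proof. by rewrite big_const_seq count_predT iter_addn_0 mulnC. Qed.

Lemma count_iota_le k c : count (fun a => a <= c) (iota 1 k) = minn c k.
Proof.
elim: k => [|k IHk]; first by rewrite minn0.
by rewrite -[k.+1]addn1 iotaD count_cat IHk /= add1n addn0; lia.
Qed.

Lemma count_iota_eq k c : count (pred1 c) (iota 1 k) = (0 < c <= k).
Proof. by rewrite count_uniq_mem ?iota_uniq // mem_iota add1n ltnS. Qed.

(** If the last letter c of w is a first occurrence, then it is the largest
    letter of w, and c + s is too large to follow it; for the second sum, where
    w is followed by a new letter, this uses s >= 2.  Otherwise the rest of w
    is any word with the same letters, and c is any of these letters: k + 1 - s
    of them satisfy c + s <= k + 1, and, if s <= k, one of them satisfies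
    c + s = k + 1. *)
Lemma last_occurrences n k :
  \sum_(w <- rgf n.+1 k.+1) \sum_(a <- iota 1 k.+1) (a == last 0 w + s : nat)
  + \sum_(w <- rgf n.+1 k) (k.+1 == last 0 w + s) =
  (s < k.+1) * ((k.+1 - s) * size (rgf n k.+1) + size (rgf n k)).
Proof.
have below c :
    \sum_(a <- iota 1 k.+1) (a == c + s : nat) = (c <= k.+1 - s) && (s <= k.+1).
  rewrite sum_count -[LHS]/(count (pred1 (c + s)) _) count_iota_eq; lia.
have -> : \sum_(w <- rgf n.+1 k.+1) \sum_(a <- iota 1 k.+1) (a == last 0 w + s : nat)
    = (s < k.+1) * ((k.+1 - s) * size (rgf n k.+1)).
  rewrite big_rgfS [X in _ + X]big1 ?addn0; last first.
    by move=> w _; rewrite last_rcons below; lia.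
  rewrite (eq_bigr (fun=> k.+1 - s)) => [|w _]; last first.
    under eq_bigr => a _ do rewrite last_rcons below.
    rewrite (sum_count (fun a => (a <= k.+1 - s) && (s <= k.+1))).
    have [le_sk|lt_ks] := leqP s k.+1; last first.
      by rewrite (eq_count (a2 := pred0)) ?count_pred0 => [|a]; rewrite ?andbF //; lia.
    rewrite (eq_count (a2 := fun a => a <= k.+1 - s)) => [|a]; last by rewrite andbT.
    by rewrite count_iota_le; lia.
  by rewrite sum_nat_seq_const /= mulnCA; case: ltnP => //=; nia.
case: k {below} => [|k].
  by rewrite big_nil; case: s s_ge2.
rewrite big_rgfS [X in _ + (_ + X)]big1 ?addn0; last first.
  by move=> w _; rewrite last_rcons; lia.
rewrite (eq_bigr (fun=> (s < k.+2) : nat)) => [|w _]; last first.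
  under eq_bigr => a _ do rewrite last_rcons.
  rewrite (sum_count (fun a => k.+2 == a + s)).
  have [le_sk|lt_ks] := leqP s k.+2; last first.
    by rewrite (eq_count (a2 := pred0)) ?count_pred0 => [|a /=]; lia.
  rewrite (eq_count (a2 := pred1 (k.+2 - s))) => [|a /=]; last by lia.
  by rewrite count_iota_eq; lia.
by rewrite sum_nat_seq_const mulnDr [size _ * _]mulnC.
Qed.

Lemma rgf_occ0 k : rgf_occ 0 k = 0.
Proof. by case: k => [|k]; rewrite /rgf_occ ?big_nil //= big_seq1. Qed.

Lemma rgf_occS n k :
  rgf_occ n.+1 k.+1 = k.+1 * rgf_occ n k.+1 + rgf_occ n k
   + (\sum_(w <- rgf n k.+1) \sum_(a <- iota 1 k.+1)
        ((w != [::]) && (a == last 0 w + s))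
      + \sum_(w <- rgf n k) ((w != [::]) && (k.+1 == last 0 w + s))).
Proof.
rewrite /rgf_occ big_rgfS addnACA -big_split /=; congr (_ + _); last first.
  by apply: eq_bigr => w _; rewrite occurrences_rcons.
rewrite big_distrr -big_split; apply: eq_bigr => w _ /=.
under eq_bigr => a _ do rewrite occurrences_rcons.
by rewrite big_split /= sum_nat_seq_const /= size_iota.
Qed.

Lemma rgf_occ1 k : rgf_occ 1 k = 0.
Proof.
case: k => [|k]; first by rewrite /rgf_occ big_nil.
rewrite rgf_occS !rgf_occ0 muln0; case: k => [|k] /=.
  by rewrite big_nil big_seq1.
by rewrite !big_nil.
Qed.

(** The count of [last_occurrences] is rewritten with [size_rgfS]; the
    subtracted term stands on the left because subtraction is truncated. *)
Lemma rgf_occ_rec n k :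
  rgf_occ n.+2 k.+1 + s * (s <= k) * size (rgf n k.+1) =
    k.+1 * rgf_occ n.+1 k.+1 + rgf_occ n.+1 k + (s <= k) * size (rgf n.+1 k.+1).
Proof.
rewrite rgf_occS size_rgfS.
rewrite (eq_big_seq
    (fun w => \sum_(a <- iota 1 k.+1) (a == last 0 w + s : nat))); last first.
  by move=> w /rgf_neq0 nz_w; apply: eq_bigr => a _; rewrite nz_w.
rewrite [X in _ + (_ + X)](eq_big_seq
    (fun w => (k.+1 == last 0 w + s) : nat)); last first.
  by move=> w /rgf_neq0 ->.
by rewrite last_occurrences ltnS; case: leqP => /=; nia.
Qed.

Lemma rgf_occ_small n k : k <= s -> rgf_occ n k = 0.
Proof.
elim: n k => [|[|n] IHn] k le_ks; rewrite ?rgf_occ0 ?rgf_occ1 //.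
case: k le_ks => [|k] lt_ks; first by rewrite /rgf_occ big_nil.
have := rgf_occ_rec n k.
by rewrite !IHn ?(ltnW lt_ks) // leqNgt lt_ks /= !muln0 !mul0n addn0.
Qed.
End Counting.

(** * Set partitions and their sequential forms *)

Section SequentialForm.
Variable n : nat.
Implicit Types (P : {set {set 'I_n}}) (B : {set 'I_n}) (i j : 'I_n).

Lemma block_min_le B i : i \in B -> block_min B <= i.
Proof.
move=> iB; rewrite /block_min; elim: (index_enum _) (mem_index_enum i) => // j r IHr.
rewrite inE big_cons => /orP[/eqP <-|/IHr]; first by rewrite iB geq_minl.
by case: ifP => // _; apply: leq_trans (geq_minr _ _).
Qed.

Lemma block_min_mem B : B != set0 -> exists2 i, i \in B & block_min B = i :> nat.
Proof.
case/set0Pn=> i0 i0B.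
case: (arg_minnP (fun i : 'I_n => i : nat) i0B) => i iB min_i; exists i => //.
apply/eqP; rewrite eqn_leq block_min_le //= /block_min.
by elim/big_ind: _ => [|a b|j /min_i] //; [exact: ltnW | rewrite leq_min => -> ->].
Qed.

(** The block order of [ordered_blocks] is strict, which makes the ordered
    list of blocks unique. *)
Lemma block_min_inj P : partition P [set: 'I_n] ->
  {in P &, injective (@block_min n)}.
Proof.
move=> parP A B AP BP eq_min.
have ne0 C : C \in P -> C != set0 by apply: contraTneq => ->; rewrite (partition0 parP).
have [i iA minA] := block_min_mem (ne0 A AP).
have [j jB minB] := block_min_mem (ne0 B BP).
have def_i : i = j by apply: val_inj; rewrite /= -minA -minB.
have tiP := partition_trivIset parP.
by rewrite -(def_pblock tiP AP iA) -(def_pblock tiP BP jB) def_i.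
Qed.

Lemma ordered_blocks_mem P : ordered_blocks P =i P.
Proof. by move=> B; rewrite mem_sort mem_enum. Qed.

Lemma ordered_blocks_size P : size (ordered_blocks P) = #|P|.
Proof. by rewrite size_sort -cardE. Qed.

Lemma ordered_blocks_sorted P : partition P [set: 'I_n] ->
  sorted (relpre (@block_min n) ltn) (ordered_blocks P).
Proof.
move=> parP; rewrite -sorted_map ltn_sorted_uniq_leq; apply/andP; split.
  rewrite map_inj_in_uniq ?sort_uniq ?enum_uniq // => A B.
  by rewrite !ordered_blocks_mem; apply: block_min_inj.
by rewrite sorted_map; apply: sort_sorted => A B; apply: leq_total.
Qed.

Lemma ordered_blocks_unique P bs : partition P [set: 'I_n] ->
  sorted (relpre (@block_min n) ltn) bs -> bs =i P -> ordered_blocks P = bs.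
Proof.
move=> parP bs_sorted bsP.
apply: (@irr_sorted_eq _ (relpre (@block_min n) ltn)) => //.
- by move=> A B C /=; apply: ltn_trans.
- by move=> A /=; rewrite ltnn.
- exact: ordered_blocks_sorted.
by move=> B; rewrite ordered_blocks_mem bsP.
Qed.

Lemma pblock_ordered P i : partition P [set: 'I_n] ->
  pblock P i \in ordered_blocks P.
Proof.
by move=> parP; rewrite ordered_blocks_mem pblock_mem // (cover_partition parP) inE.
Qed.

Lemma size_sequential_form P : size (sequential_form P) = n.
Proof. by rewrite size_map size_enum_ord. Qed.

Lemma nth_sequential_form P i :
  nth 0 (sequential_form P) i = (index (pblock P i) (ordered_blocks P)).+1.
Proof. by rewrite (nth_map i) ?size_enum_ord // nth_ord_enum. Qed.

Lemma sequential_form_eq P i j : partition P [set: 'I_n] ->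
  (nth 0 (sequential_form P) i == nth 0 (sequential_form P) j)
  = (pblock P i == pblock P j).
Proof.
move=> parP; rewrite !nth_sequential_form eqSS; apply/eqP/eqP => [|-> //].
by move=> e; rewrite -(nth_index set0 (pblock_ordered i parP)) e nth_index ?pblock_ordered.
Qed.

Lemma sequential_form_inj k :
  {in set_partitions n k &, injective (@sequential_form n)}.
Proof.
move=> P P'; rewrite !inE => /andP[parP _] /andP[parP' _] eqPP'.
have same i j : (pblock P i == pblock P j) = (pblock P' i == pblock P' j).
  by rewrite -!sequential_form_eq // eqPP'.
have eq_pblock i : pblock P i = pblock P' i.
  have in_block Q : partition Q [set: 'I_n] -> forall j,
      (j \in pblock Q i) = (pblock Q i == pblock Q j).
    move=> parQ j; rewrite eq_pblock ?(partition_trivIset parQ) //.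
    by rewrite (cover_partition parQ) inE.
  by apply/setP => j; rewrite !in_block // same.
have sub Q Q' : partition Q [set: 'I_n] -> partition Q' [set: 'I_n] ->
    (forall i, pblock Q i = pblock Q' i) -> {subset Q <= Q'}.
  move=> parQ parQ' eqQ B BQ.
  have /set0Pn[i iB] : B != set0.
    by apply: contraTneq BQ => ->; rewrite (partition0 parQ).
  rewrite -(def_pblock (partition_trivIset parQ) BQ iB) eqQ.
  by rewrite pblock_mem // (cover_partition parQ') inE.
by apply/setP => B; apply/idP/idP; apply: sub.
Qed.

(** The minimum of the b-th block is the first position of the letter b, and
    these positions increase with b. *)
Lemma sequential_form_is_rgf P k : P \in set_partitions n k ->
  is_rgf n k (sequential_form P).
Proof.
rewrite inE => /andP[parP /eqP cardP].
have letter B i : B \in P -> i \in B ->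
    nth 0 (sequential_form P) i = (index B (ordered_blocks P)).+1.
  move=> BP iB; rewrite nth_sequential_form.
  by rewrite (def_pblock (partition_trivIset parP) BP iB).
(* The letter b + 1 occurs first at the minimum of the block of index b. *)
have minP b : b < k -> exists2 i : 'I_n, nth 0 (sequential_form P) i = b.+1 &
    block_min (nth set0 (ordered_blocks P) b) = i.
  move=> lt_bk; set B := nth _ _ _.
  have lt_b : b < size (ordered_blocks P) by rewrite ordered_blocks_size cardP.
  have BP : B \in P by rewrite -ordered_blocks_mem mem_nth.
  have /block_min_mem[i iB minB] : B != set0.
    by apply: contraTneq BP => ->; rewrite (partition0 parP).
  exists i => //; rewrite (letter B) // /B index_uniq //.
  by rewrite sort_uniq enum_uniq.
split; first exact: size_sequential_form.
  move=> c; apply/idP/idP.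
    case/mapP=> i _ ->; rewrite -cardP -ordered_blocks_size index_mem.
    exact: pblock_ordered.
  case: c => // b /minP[i <- _]; apply: mem_nth.
  by rewrite size_sequential_form.
move=> i c lt_in; pose i' := Ordinal lt_in.
rewrite -[i]/(i' : nat) nth_sequential_form.
case: c => // b; rewrite /= ltnS => le_b.
have lt_c : index (pblock P i') (ordered_blocks P) < size (ordered_blocks P).
  by rewrite index_mem pblock_ordered.
have lt_bk : b < k by rewrite -cardP -ordered_blocks_size; apply: leq_ltn_trans lt_c.
have [j wj minj] := minP b lt_bk.
(* Blocks of smaller index have smaller minima, so c has occurred by i. *)
have le_ji : j <= i.
  rewrite -minj; apply: leq_trans (_ : block_min (pblock P i') <= _); last first.
    apply: (block_min_le (i := i')).
    by rewrite mem_pblock (cover_partition parP) inE.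
  rewrite -[X in _ <= block_min X](nth_index set0 (pblock_ordered i' parP)).
  move: le_b; rewrite leq_eqVlt => /orP[/eqP-> //|lt_b]; apply: ltnW.
  have := @sorted_ltn_nth _ (relpre (@block_min n) ltn) _ set0 _
    (ordered_blocks_sorted parP).
  apply=> //; first by move=> A B C /=; apply: ltn_trans.
  by rewrite inE; apply: ltn_trans lt_c.
rewrite -wj; rewrite -(nth_take (n0 := i.+1)) ?ltnS //; apply: mem_nth.
by rewrite size_take size_sequential_form; case: ifP => // _; exact: ltn_ord.
Qed.

(** The partition is the one into level sets of w; restricted growth says that
    the level sets, taken in the order of their letters, have increasing
    minima. *)
Lemma sequential_form_onto k w : is_rgf n k w ->
  exists2 P, P \in set_partitions n k & sequential_form P = w.
Proof.
case=> sz_w mem_w pre_w.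
pose f i := nth 0 w i; pose T c := [set i | f i == c].
pose P := preim_partition f [set: 'I_n].
have parP : partition P [set: 'I_n] by apply: preim_partitionP.
have tiP := partition_trivIset parP.
have eqR : {in [set: 'I_n] & &, equivalence_rel [rel i j : 'I_n | f i == f j]}.
  by move=> i1 i2 i3 _ _ _; split=> //= /eqP->.
have pblockE i : pblock P i = T (f i).
  apply/setP => j; rewrite inE.
  by rewrite (pblock_equivalence_partition eqR) ?inE //= eq_sym.
have T_min c : 1 <= c <= k -> exists2 i : 'I_n, f i = c & block_min (T c) = i.
  rewrite -mem_w => /(nthP 0)[i]; rewrite sz_w => lt_in def_c.
  have /block_min_mem[j] : T c != set0.
    by apply/set0Pn; exists (Ordinal lt_in); rewrite inE /f /= def_c.
  by rewrite inE => /eqP fj minj; exists j.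
pose bs := map T (iota 1 k).
have bsP : bs =i P.
  move=> B; apply/mapP/idP => [[c]|BP].
    rewrite mem_iota add1n ltnS => /T_min[i <- _] ->.
    by rewrite -pblockE pblock_mem // (cover_partition parP) inE.
  have /set0Pn[i iB] : B != set0.
    by apply: contraTneq BP => ->; rewrite (partition0 parP).
  exists (f i); last by rewrite -pblockE (def_pblock tiP BP iB).
  by rewrite mem_iota add1n ltnS -mem_w mem_nth ?sz_w.
(* Restricted growth places some c before the first occurrence of c'. *)
have T_lt c c' : 1 <= c -> c < c' -> c' <= k -> block_min (T c) < block_min (T c').
  move=> c_gt0 lt_cc' le_c'k.
  have [|i' fi' ->] := T_min c'; first by lia.
  have /(nthP 0)[j] : c \in take i'.+1 w by apply: pre_w => //; rewrite -/(f i') fi'; lia.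
  rewrite size_take => lt_j; have {}lt_j : j < i'.+1 by move: lt_j; case: ifP => //; lia.
  rewrite nth_take // => wj.
  have lt_jn : j < n by apply: leq_trans lt_j (ltn_ord i').
  have le1 : block_min (T c) <= j.
    by apply: (block_min_le (i := Ordinal lt_jn)); rewrite inE /f /= wj.
  apply: leq_ltn_trans le1 _; rewrite ltn_neqAle -ltnS lt_j andbT.
  by apply: contraTneq lt_cc' => eq_j; rewrite -wj eq_j -fi' ltnn.
have bs_sorted : sorted (relpre (@block_min n) ltn) bs.
  rewrite sorted_map; apply: (sub_in_sorted (P := fun c => 1 <= c <= k) (e := ltn)).
  - move=> c c'; rewrite !unfold_in => /andP[c1 _] /andP[_ c'k] /= lt_c.
    exact: T_lt.
  - by apply/allP => c; rewrite mem_iota; lia.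
  exact: iota_ltn_sorted.
have obP : ordered_blocks P = bs by apply: ordered_blocks_unique.
have T_inj : {in iota 1 k &, injective T}.
  move=> c c'; rewrite !mem_iota => c1 c1' eqT.
  have := T_lt c c'; have := T_lt c' c; rewrite eqT ltnn.
  by case: (ltngtP c c'); lia.
exists P.
  rewrite inE parP -ordered_blocks_size obP size_map size_iota eqxx //.
apply: (@eq_from_nth _ 0); first by rewrite size_sequential_form sz_w.
move=> i; rewrite size_sequential_form => lt_in.
rewrite -[i]/(Ordinal lt_in : nat) nth_sequential_form obP pblockE.
have fi : f (Ordinal lt_in) \in iota 1 k.
  by rewrite mem_iota add1n ltnS -mem_w mem_nth ?sz_w.
rewrite -[RHS]/(f (Ordinal lt_in)) -[RHS](nth_index_map 0 T_inj fi).
rewrite nth_iota ?add1n // -[k in _ < k](size_iota 1).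
by rewrite -[X in _ < X](size_map T) index_mem map_f.
Qed.
End SequentialForm.

Lemma total_occurrencesE s n k : total_occurrences s n k = rgf_occ s n k.
Proof.
rewrite /total_occurrences -big_enum -(big_map (@sequential_form n) predT (occurrences s)).
apply: perm_big; apply: uniq_perm.
- rewrite map_inj_in_uniq ?enum_uniq // => P P'; rewrite !mem_enum.
  exact: (@sequential_form_inj n k).
- exact: rgf_uniq.
move=> w; apply/mapP/idP => [[P]|/mem_rgf/sequential_form_onto[P PP <-]].
  by rewrite mem_enum => /sequential_form_is_rgf/mem_rgf ? ->.
by exists P; rewrite ?mem_enum.
Qed.

Local Open Scope ring_scope.

(** * Coefficients of power series *)

Section Coefficients.
Variable n : nat.
Implicit Types (f g h : mfps n) (m k : 'X_{1..n}) (i j : 'I_n).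

Lemma mfpsP f g : (forall m, f m = g m) -> f = g.
Proof. by move=> eq_fg; apply: boolp.funext. Qed.

Lemma mfpsD f g m : (f + g) m = f m + g m. Proof. by []. Qed.
Lemma mfpsN f m : (- f) m = - f m. Proof. by []. Qed.
Lemma mfpsB f g m : (f - g) m = f m - g m. Proof. by []. Qed.
Lemma mfps0 m : (0 : mfps n) m = 0. Proof. by []. Qed.
Lemma mfps1 m : (1 : mfps n) m = (m == 0%MM)%:R. Proof. by []. Qed.
Lemma mfpsZ a f m : (a *: f) m = a * f m. Proof. by []. Qed.

Definition mfpsE := (mfpsD, mfpsN, mfps0, mfps1, mfpsZ).

Lemma mfps_sum I (s : seq I) (P : pred I) (F : I -> mfps n) m :
  (\sum_(a <- s | P a) F a) m = \sum_(a <- s | P a) F a m.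
Proof. by elim/big_rec2: _ => // a x f _ <-. Qed.

Lemma mfpsMnl f d m : (f *+ d) m = f m *+ d.
Proof. by elim: d => [|d IHd]; rewrite ?mulr0n // !mulrS mfpsD IHd. Qed.

Lemma mfps_natmul d f m : (d%:R * f) m = d%:R * f m.
Proof. by rewrite mulr_natl mfpsMnl mulr_natl. Qed.

Lemma mfpsME d f g m : (mdeg m < d)%N ->
  (f * g) m = (mfps_trunc d f * mfps_trunc d g)@_m.
Proof. exact: mfps_mulE. Qed.

Lemma mfps_trunc_low d f m : (mdeg m < d)%N -> (mfps_trunc d f)@_m = f m.
Proof. by rewrite mcoeff_mfps_trunc => ->. Qed.

Lemma mfpsM_low f f' g g' m :
    (forall k, (mdeg k <= mdeg m)%N -> f k = f' k) ->
    (forall k, (mdeg k <= mdeg m)%N -> g k = g' k) ->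
  (f * g) m = (f' * g') m.
Proof.
move=> eq_f eq_g; rewrite !(mfpsME _ _ (ltnSn _)).
apply: mcoeffM_low => k le_km; rewrite !mfps_trunc_low ?ltnS //.
  exact: eq_f.
exact: eq_g.
Qed.

Lemma mfpsM_neq0 f g m : (f * g) m != 0 ->
  exists k1 k2, [/\ m = (k1 + k2)%MM, f k1 != 0 & g k2 != 0].
Proof.
move=> nz; case: (boolP [exists k : 'X_{1..n < (mdeg m).+1, (mdeg m).+1},
    (m == (k.1 + k.2)%MM) && (f k.1 * g k.2 != 0)]).
  case/existsP=> -[k1 k2] /= /andP[/eqP def_m]; rewrite mulf_eq0 => /norP[nz1 nz2].
  by exists (k1 : 'X_{1..n}), (k2 : 'X_{1..n}).
rewrite negb_exists => /forallP all0; case/eqP: nz.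
by apply: big1 => k def_m; have := all0 k; rewrite def_m negbK => /eqP.
Qed.

Lemma mfps_varM i f m :
  (mfps_var i * f) m = if m i == 0%N then 0 else f (m - U_(i))%MM.
Proof.
case: eqP => [m0|/eqP m_gt0].
  apply/eqP; apply: contraTT isT => /mfpsM_neq0[k1 [k2 [def_m]]].
  rewrite /mfps_var; case: (k1 =P U_(i)%MM) => [eq_k _ _|_]; last by rewrite eqxx.
  by move: m0; rewrite def_m mnmDE eq_k mnm1E eqxx.
have lt_d : (mdeg m < (mdeg m).+2)%N by lia.
transitivity ((mfps_trunc (mdeg m).+2 f * 'X_i)@_m).
  rewrite (mfpsME _ _ lt_d) mulrC; apply: mcoeffM_low => // k le_km.
  by rewrite mfps_trunc_low ?mcoeffX ?ltnS ?leqW // /mfps_var eq_sym.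
have le_im : (U_(i) <= m)%MM.
  apply/mnm_lepP => j; rewrite mnm1E; case: eqP => // <-; lia.
rewrite -[X in _@_X](submK le_im) addmC mcoeffMX mfps_trunc_low //.
by apply: leq_ltn_trans (mdegB _ _) _; lia.
Qed.

(** X_i f is homogeneous of degree 1 in X_i when f is free of X_i, so that its
    d-th power only has monomials of degree d in X_i. *)
Lemma mfps_var_exp_hom i f d m :
    (forall k, k i != 0%N -> f k = 0) ->
  ((mfps_var i * f) ^+ d) m != 0 -> m i = d.
Proof.
move=> free_f; elim: d m => [|d IHd] m.
  by rewrite expr0 mfps1; case: (m =P 0%MM) => [->|]; rewrite ?mnm0E ?eqxx.
rewrite exprS -mulrA mfps_varM; case: (m i =P 0%N) => [|m_i]; first by rewrite eqxx.
case/mfpsM_neq0=> k1 [k2 [def_m nz1 /IHd <-]].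
have k1i : k1 i = 0%N by apply: contraNeq nz1 => /free_f ->.
have := congr1 (fun u : 'X_{1..n} => u i) def_m.
by rewrite mnmBE mnmDE mnm1E eqxx k1i; lia.
Qed.

End Coefficients.

(** * Partial derivatives, exponentials and antiderivatives *)

Section Derivation.
Variable n : nat.
Implicit Types (f g h : mfps n) (m k : 'X_{1..n}) (i j : 'I_n).

Definition fderiv i f : mfps n := fun m => f (m + U_(i))%MM *+ (m i).+1.

Lemma fderivE i f m : fderiv i f m = f (m + U_(i))%MM *+ (m i).+1.
Proof. by []. Qed.

Lemma fderivD i f g : fderiv i (f + g) = fderiv i f + fderiv i g.
Proof. by apply: mfpsP => m; rewrite !(mfpsE, fderivE) mulrnDl. Qed.
Lemma fderivN i f : fderiv i (- f) = - fderiv i f.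
Proof. by apply: mfpsP => m; rewrite !(mfpsE, fderivE) mulNrn. Qed.
Lemma fderiv0 i : fderiv i (0 : mfps n) = 0.
Proof. by apply: mfpsP => m; rewrite !(mfpsE, fderivE) mul0rn. Qed.
Lemma fderivZ i a f : fderiv i (a *: f) = a *: fderiv i f.
Proof. by apply: mfpsP => m; rewrite !(mfpsE, fderivE) mulrnAr. Qed.

(** Both sides only involve finitely many coefficients, so the identity is
    Leibniz' rule for polynomial truncations of f and g. *)
Lemma fderivM i f g : fderiv i (f * g) = fderiv i f * g + f * fderiv i g.
Proof.
apply: mfpsP => m; rewrite mfpsD fderivE.
set d := (mdeg m).+2.
have lt_d : (mdeg (m + U_(i)) < d)%N by rewrite mdegD mdeg1 addn1.
have lt_d' : (mdeg m < d)%N by rewrite /d; lia.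
rewrite (mfpsME _ _ lt_d) -mcoeff_mderiv mderivM mcoeffD !(mfpsME _ _ lt_d').
have low k h : (mdeg k <= mdeg m)%N ->
    (mfps_trunc d h)^`M(i)@_k = (mfps_trunc d (fderiv i h))@_k.
  by move=> le_km; rewrite mcoeff_mderiv !mfps_trunc_low // ?mdegD ?mdeg1 /d; lia.
by congr (_ + _); apply: mcoeffM_low => // k; apply: low.
Qed.

Lemma fderiv_var i j : fderiv i (mfps_var j) = (i == j)%:R.
Proof.
apply: mfpsP => m; rewrite fderivE /mfps_var.
case: (eqVneq i j) => [<-|ne_ij]; last first.
  case: eqP => [/(congr1 (fun u : 'X_{1..n} => u i))|_]; last by rewrite mul0rn.
  by rewrite mnmDE !mnm1E eqxx eq_sym (negPf ne_ij) addn1.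
rewrite -[X in _ == X]add0m (can_eq (addmK U_(i))) -[true%:R]/1 mfps1.
by case: eqP => [->|_]; rewrite ?mnm0E // mul0rn.
Qed.

Lemma fderiv1 i : fderiv i (1 : mfps n) = 0.
Proof.
have := fderivM i 1 1; rewrite !mulr1 mul1r => /eqP.
by rewrite -subr_eq subrr eq_sym => /eqP.
Qed.

Lemma fderiv_nat i d : fderiv i (d%:R : mfps n) = 0.
Proof.
elim: d => [|d IHd]; first exact: fderiv0.
by rewrite -addn1 natrD fderivD IHd fderiv1 addr0.
Qed.

Lemma fderiv_sum i I (s : seq I) (P : pred I) (F : I -> mfps n) :
  fderiv i (\sum_(a <- s | P a) F a) = \sum_(a <- s | P a) fderiv i (F a).
Proof. by apply: (big_morph _ (fderivD i) (fderiv0 i)). Qed.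

Lemma fderivXn i f d : fderiv i (f ^+ d.+1) = d.+1%:R * fderiv i f * f ^+ d.
Proof.
elim: d => [|d IHd]; first by rewrite expr1 expr0 mul1r mulr1.
rewrite exprS fderivM IHd exprS -[d.+2]addn1 natrD.
by move: (d.+1%:R) (f ^+ d) (fderiv i f) => a b c; ring.
Qed.

Lemma fderiv_fexp_truncS i f d :
  fderiv i (fexp_trunc d.+1 f) = fderiv i f * fexp_trunc d f.
Proof.
rewrite /fexp_trunc fderiv_sum big_ord_recl /= fderivZ expr0 fderiv1 scaler0 add0r.
rewrite mulr_sumr; apply: eq_bigr => a _; rewrite fderivZ fderivXn.
rewrite -scalerAr mulrAC -mulrA -[_.+1%:R]scaler_nat -scalerAl mul1r scalerA.
congr (_ *: _); last by rewrite mulrC.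
by rewrite /bump /= factS natrM invfM mulrAC mulVf ?mul1r ?pnatr_eq0.
Qed.

Lemma mfpsX_low f d m : f 0%MM = 0 -> (mdeg m < d)%N -> (f ^+ d) m = 0.
Proof.
move=> f0; elim: d m => [|d IHd] m //; rewrite ltnS => le_md.
rewrite exprS; apply/eqP; apply: contraTT isT => /mfpsM_neq0[k1 [k2 [def_m nz1]]].
rewrite IHd ?eqxx //; apply: leq_trans le_md; rewrite def_m mdegD.
have : mdeg k1 != 0%N by rewrite mdeg_eq0; apply: contraNneq nz1 => ->; rewrite f0.
by lia.
Qed.

(** As f has no constant term, the powers of f beyond the degree of a monomial
    do not contain it, whence [fexp] may be replaced by any long enough partial sum. *)
Lemma fexp_trunc_low f d m : f 0%MM = 0 -> (mdeg m <= d)%N ->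
  fexp_trunc d f m = fexp f m.
Proof.
move=> f0 le_md; rewrite /fexp /fexp_trunc !mfps_sum.
rewrite -(subnKC le_md) -addSn big_split_ord /= [X in _ + X]big1 ?addr0 //.
by move=> a _; rewrite mfpsZ mfpsX_low ?mulr0 //=; lia.
Qed.

Lemma fderiv_fexp i f : f 0%MM = 0 -> fderiv i (fexp f) = fderiv i f * fexp f.
Proof.
move=> f0; apply: mfpsP => m.
rewrite fderivE -(@fexp_trunc_low _ (mdeg m).+1) ?mdegD ?mdeg1 ?addn1 //.
rewrite -fderivE fderiv_fexp_truncS; apply: mfpsM_low => // k le_km.
exact: fexp_trunc_low.
Qed.

(** Over the rationals, a zero derivative characterizes independence of a
    variable; this is how freeness of X_i is expressed below. *)
Lemma mfps_free0 i f m : fderiv i f = 0 -> m i != 0%N -> f m = 0.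
Proof.
move=> Df0 m_i; have le_im : (U_(i) <= m)%MM.
  apply/mnm_lepP => j; rewrite mnm1E; case: eqP => // <-; lia.
have := congr1 (fun h : mfps n => h (m - U_(i))%MM) Df0.
by rewrite fderivE submK // mfps0 => /eqP; rewrite mulrn_eq0 => /eqP.
Qed.

Lemma fderiv_inj i f g : fderiv i f = fderiv i g ->
  (forall m, m i = 0%N -> f m = g m) -> f = g.
Proof.
move=> eqD eq0; apply: mfpsP => m.
have [/eq0 //|/eqP m_i] := m i =P 0%N.
apply/eqP; rewrite -subr_eq0 -mfpsB; apply/eqP/(@mfps_free0 i) => //.
by rewrite fderivD fderivN eqD subrr.
Qed.

Lemma fprim0 i f m : m i = 0%N -> fprim i f m = 0.
Proof. by rewrite /fprim => ->. Qed.

Lemma fderiv_fprim i f : fderiv i (fprim i f) = f.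
Proof.
apply: mfpsP => m; rewrite fderivE /fprim mnmDE mnm1E eqxx addn1 /= addmK.
by rewrite -[LHS]mulr_natr mulfVK // pnatr_eq0.
Qed.

Lemma fderivC i j f : fderiv i (fderiv j f) = fderiv j (fderiv i f).
Proof.
apply: mfpsP => m; rewrite !fderivE -!mulrnA !mnmDE !mnm1E.
rewrite -!addmA [(U_(j) + _)%MM]addmC; congr (_ *+ _).
have [->|_] := eqVneq i j; first by lia.
by rewrite addn0 mulnC addn0.
Qed.

(** An antiderivative is determined by its derivative and its value at X_i = 0,
    so identities between antiderivatives follow from those between
    derivatives. *)
Lemma fprim_unique i f g : fderiv i f = g -> (forall m, m i = 0%N -> f m = 0) ->
  fprim i g = f.
Proof.
move=> Df f0; apply: (@fderiv_inj i); first by rewrite fderiv_fprim.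
by move=> m m_i; rewrite fprim0 // f0.
Qed.

Lemma fprimD i f g : fprim i (f + g) = fprim i f + fprim i g.
Proof.
apply: fprim_unique; first by rewrite fderivD !fderiv_fprim.
by move=> m m_i; rewrite mfpsD !fprim0 // addr0.
Qed.

Lemma fprimN i f : fprim i (- f) = - fprim i f.
Proof.
apply: fprim_unique; first by rewrite fderivN !fderiv_fprim.
by move=> m m_i; rewrite mfpsN !fprim0 // oppr0.
Qed.

Lemma fprim_fderiv i j f : i != j ->
  fprim i (fderiv j f) = fderiv j (fprim i f).
Proof.
move=> ne_ij; apply: fprim_unique; first by rewrite fderivC fderiv_fprim.
by move=> m m_i; rewrite fderivE fprim0 ?mul0rn // mnmDE m_i mnm1E eq_sym (negPf ne_ij).
Qed.

Lemma fprim_varM i j f : i != j ->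
  fprim i (mfps_var j * f) = mfps_var j * fprim i f.
Proof.
move=> ne_ij; apply: fprim_unique.
  by rewrite fderivM fderiv_var (negPf ne_ij) mul0r add0r fderiv_fprim.
move=> m m_i; rewrite mfps_varM; case: ifP => // _.
by rewrite fprim0 // mnmBE m_i sub0n.
Qed.

End Derivation.

(** * Substitution of one variable for another *)

Section Substitution.
Variables (n : nat) (i j : 'I_n).
Hypothesis ne_ij : i != j.
Implicit Types (f g h : mfps n) (m k : 'X_{1..n}).

Local Notation subst := (fsubst_var i j).

(** The monomials that the substitution sends to m, for m free of X_i, are
    indexed by their degree a in X_i. *)
Definition msplit m a : 'X_{1..n} := (m - U_(j) *+ a + U_(i) *+ a)%MM.

Lemma fsubst_varE f m : m i = 0%N ->
  subst f m = \sum_(a < (m j).+1) f (msplit m a).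
Proof. by rewrite /fsubst_var => ->. Qed.

Lemma fsubst_var_neq0 f m : m i != 0%N -> subst f m = 0.
Proof. by rewrite /fsubst_var => /negPf->. Qed.

Lemma fsubst_varD f g : subst (f + g) = subst f + subst g.
Proof.
apply: mfpsP => m; rewrite mfpsD; have [m0|m_i] := eqVneq (m i) 0%N.
  by rewrite !fsubst_varE // -big_split.
by rewrite !fsubst_var_neq0 ?addr0.
Qed.

Lemma fsubst_varZ a f : subst (a *: f) = a *: subst f.
Proof.
apply: mfpsP => m; rewrite mfpsZ; have [m0|m_i] := eqVneq (m i) 0%N.
  by rewrite !fsubst_varE // mulr_sumr.
by rewrite !fsubst_var_neq0 ?mulr0.
Qed.

Lemma fsubst_varN f : subst (- f) = - subst f.
Proof. by rewrite -scaleN1r fsubst_varZ scaleN1r. Qed.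

Lemma fsubst_var0 : subst 0 = 0.
Proof. by rewrite -(scale0r (0 : mfps n)) fsubst_varZ !scale0r. Qed.

Definition msubst m : 'X_{1..n} := (m - U_(i) *+ m i + U_(j) *+ m i)%MM.

Lemma msubstE m l :
  msubst m l =
    if l == i then 0%N else if l == j then (m j + m i)%N else m l.
Proof.
rewrite /msubst mnmDE mnmBE !mulmnE !mnm1E ![_ == l]eq_sym.
case: (eqVneq l i) => [->|_]; first by rewrite (negPf ne_ij); lia.
by case: eqVneq => [->|_]; lia.
Qed.

Lemma msplitE m a l : m i = 0%N ->
  msplit m a l = if l == i then a else if l == j then (m j - a)%N else m l.
Proof.
move=> m_i; rewrite mnmDE mnmBE !mulmnE !mnm1E ![_ == l]eq_sym.
case: (eqVneq l i) => [->|_]; first by rewrite (negPf ne_ij) m_i; lia.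
by case: eqVneq => [->|_]; lia.
Qed.

Lemma msubst_msplit m a : m i = 0%N -> (a <= m j)%N -> msubst (msplit m a) = m.
Proof.
move=> m_i le_a; apply/mnmP => l; rewrite msubstE; case: eqP => [->|/eqP nli] //.
rewrite !msplitE // eqxx [j == i]eq_sym (negPf ne_ij) eqxx (negPf nli).
by case: eqP => // ->; lia.
Qed.

Lemma mdeg_msubst m : mdeg (msubst m) = mdeg m.
Proof.
have le_m : (U_(i) *+ m i <= m)%MM.
  by apply/mnm_lepP => l; rewrite mulmnE mnm1E; case: eqP => [->|_]; lia.
by rewrite -[in RHS](submK le_m) /msubst !mdegD !mdegMn !mdeg1.
Qed.

Definition psubst (p : {mpoly rat[n]}) : {mpoly rat[n]} :=
  p \mPo [tuple if l == i then 'X_j else 'X_l | l < n].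

Lemma psubstX m : psubst 'X_[m] = 'X_[msubst m].
Proof.
rewrite /psubst comp_mpolyX [RHS]mpolyXE_id.
rewrite (bigD1 i) // (bigD1 j) 1?eq_sym //=.
rewrite [in RHS](bigD1 i) //= [in RHS](bigD1 j) 1?eq_sym //=.
rewrite !tnth_mktuple !msubstE eqxx [j == i]eq_sym (negPf ne_ij) eqxx mul1r.
rewrite mulrA -exprD addnC; congr (_ * _); apply: eq_bigr => l /andP[/negPf nli /negPf nlj].
by rewrite tnth_mktuple msubstE nli nlj.
Qed.

Lemma psubst_low (p q : {mpoly rat[n]}) m :
  (forall k, (mdeg k <= mdeg m)%N -> p@_k = q@_k) -> (psubst p)@_m = (psubst q)@_m.
Proof.
move=> eq_pq; apply/eqP; rewrite -subr_eq0 -mcoeffB /psubst -comp_mpolyB.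
rewrite (mpolyE (p - q)) (raddf_sum (comp_mpoly _)) raddf_sum big1 //= => k _.
rewrite comp_mpolyZ -/(psubst _) psubstX mcoeffZ mcoeffX.
case: eqP => [eq_k|_]; last by rewrite mulr0.
by rewrite mcoeffB eq_pq ?subrr ?mul0r // -eq_k mdeg_msubst.
Qed.

(** The substitution preserves degrees, so that on each coefficient it agrees
    with the substitution in a polynomial truncation, which is a ring
    morphism. *)
Lemma fsubst_var_psubst d f m : (mdeg m < d)%N ->
  subst f m = (psubst (mfps_trunc d f))@_m.
Proof.
move=> lt_md; rewrite /psubst /mfps_trunc (raddf_sum (comp_mpoly _)) raddf_sum /=.
have [m_i|m_i] := eqVneq (m i) 0%N; last first.
  rewrite fsubst_var_neq0 // big1 // => k _.
  rewrite comp_mpolyZ -/(psubst _) psubstX mcoeffZ mcoeffX.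
  case: eqP => [eq_k|_]; last by rewrite mulr0.
  by move: m_i; rewrite -eq_k msubstE eqxx.
rewrite fsubst_varE //.
under [RHS]eq_bigr => k _ do
  rewrite comp_mpolyZ -/(psubst _) psubstX mcoeffZ mcoeffX mulr_natr mulrb.
rewrite -big_mkcond /=.
pose back (a : 'I_(m j).+1) := msplit m a.
have lt_back a : (mdeg (back a) < d)%N.
  by rewrite -mdeg_msubst msubst_msplit // -ltnS.
rewrite (reindex_onto (fun a => BMultinom (lt_back a)) 
  (fun k : 'X_{1..n < d} => inord (k i))) /=.
  apply: eq_big => [a|a _]; last exact: erefl.
  rewrite msubst_msplit ?eqxx ?msplitE ?eqxx //; last by rewrite -ltnS.
  by apply/esym/eqP/val_inj; rewrite /= inordK.
move=> k /eqP eq_k; apply/val_inj/mnmP => l; rewrite /= msplitE ?msubst_i //.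
have le_ki : (k i < (m j).+1)%N.
  by rewrite -eq_k msubstE eqxx [j == i]eq_sym (negPf ne_ij); lia.
rewrite inordK //; case: eqP => [-> //|/eqP nli].
rewrite -eq_k !msubstE eqxx [j == i]eq_sym (negPf ne_ij) (negPf nli).
by case: eqP => [->|//]; lia.
Qed.

Lemma fsubst_varM f g : subst (f * g) = subst f * subst g.
Proof.
apply: mfpsP => m; rewrite (mfpsME _ _ (ltnSn _)) (fsubst_var_psubst _ (ltnSn _)).
set d := (mdeg m).+1.
transitivity ((psubst (mfps_trunc d f * mfps_trunc d g))@_m).
  apply: psubst_low => k le_km.
  by rewrite mfps_trunc_low ?ltnS // (@mfpsME _ d).
rewrite /psubst rmorphM; apply: mcoeffM_low => k le_km;
  by rewrite -/(psubst _) -fsubst_var_psubst ?mfps_trunc_low.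
Qed.

Lemma fsubst_var1 : subst 1 = 1.
Proof.
apply: mfpsP => m; rewrite mfps1.
have [m0|m_i] := eqVneq (m i) 0%N; last first.
  rewrite fsubst_var_neq0 //; case: (m =P 0%MM) m_i => // ->.
  by rewrite mnm0E.
rewrite fsubst_varE // big_ord_recl /= /msplit !mulm0n addm0 subm0 big1 ?addr0 // => a _.
rewrite mfps1; case: eqP => // /(congr1 (fun u : 'X_{1..n} => u i)).
by rewrite mnmDE !mulmnE mnm1E eqxx mnm0E /bump /=; lia.
Qed.

Lemma fsubst_varX f d : subst (f ^+ d) = subst f ^+ d.
Proof. by elim: d => [|d IHd]; rewrite ?fsubst_var1 // !exprS fsubst_varM IHd. Qed.

Lemma fsubst_var_nat d : subst d%:R = d%:R.
Proof.
by elim: d => [|d IHd]; rewrite ?fsubst_var0 // -addn1 !natrD fsubst_varD IHd fsubst_var1.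
Qed.

Lemma fsubst_var_fexp_trunc d f : subst (fexp_trunc d f) = fexp_trunc d (subst f).
Proof.
rewrite /fexp_trunc (big_morph _ fsubst_varD fsubst_var0).
by apply: eq_bigr => a _; rewrite fsubst_varZ fsubst_varX.
Qed.

(** Degrees being preserved, the partial sum of the exponential prescribed by m
    is also the one prescribed by each monomial substituted to m. *)
Lemma fsubst_var_fexp f : subst (fexp f) = fexp (subst f).
Proof.
apply: mfpsP => m; rewrite {2}/fexp -fsubst_var_fexp_trunc.
have [m0|m_i] := eqVneq (m i) 0%N; last by rewrite !fsubst_var_neq0.
rewrite !fsubst_varE //; apply: eq_bigr => a _; rewrite /fexp.
congr (fexp_trunc _ _ _).
by rewrite -mdeg_msubst msubst_msplit // -ltnS.
Qed.

Lemma fderiv_fsubst_var_other l f : l != i -> l != j ->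
  fderiv l (subst f) = subst (fderiv l f).
Proof.
move=> nli nlj; apply: mfpsP => m; rewrite fderivE.
have ml (u : 'I_n) : u != l -> (m + U_(l))%MM u = m u.
  by move=> nul; rewrite mnmDE mnm1E eq_sym (negPf nul) addn0.
have mi : (m + U_(l))%MM i = m i by rewrite ml // eq_sym.
have mj : (m + U_(l))%MM j = m j by rewrite ml // eq_sym.
have [m0|m_i] := eqVneq (m i) 0%N; last by rewrite !fsubst_var_neq0 ?mi ?mul0rn.
rewrite !fsubst_varE ?mi // mj -sumrMnl; apply: eq_bigr => a _; rewrite fderivE.
congr (f _ *+ _.+1).
  apply/mnmP => u; rewrite !(mnmDE, mnmBE, mulmnE, mnm1E).
  by case: (eqVneq l u) => [<-|_]; rewrite ?(negPf nlj) ?[j == l]eq_sym ?(negPf nlj); lia.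
rewrite !(mnmDE, mnmBE, mulmnE, mnm1E) [i == l]eq_sym [j == l]eq_sym (negPf nli) (negPf nlj).
by lia.
Qed.

(** Chain rule for f(..., X_j, ..., X_j, ...): in the coefficient of a monomial
    of degree d + 1 in X_j, the factor d + 1 is split as (d + 1 - a) + a, where
    a is the part of the degree that comes from X_i. *)
Lemma fderiv_fsubst_var f : fderiv j (subst f) = subst (fderiv j f + fderiv i f).
Proof.
apply: mfpsP => m; rewrite fderivE.
have mi : (m + U_(j))%MM i = m i by rewrite mnmDE mnm1E eq_sym (negPf ne_ij) addn0.
have mj : (m + U_(j))%MM j = (m j).+1 by rewrite mnmDE mnm1E eqxx addn1.
have [m0|m_i] := eqVneq (m i) 0%N; last by rewrite !fsubst_var_neq0 ?mi ?mul0rn.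
rewrite fsubst_varD mfpsD !fsubst_varE ?mi // mj.
pose g a := f (msplit (m + U_(j)) a).
rewrite -/(\sum_(a < (m j).+2) g a) -sumrMnl.
transitivity (\sum_(a < (m j).+2) (g a *+ ((m j).+1 - a) + g a *+ a)).
  by apply: eq_bigr => a _; rewrite -mulrnDr subnK // -ltnS.
rewrite big_split /=; congr (_ + _).
  rewrite big_ord_recr /= subnn mulr0n addr0; apply: eq_bigr => a _.
  rewrite fderivE /g /msplit; congr (f _ *+ _).
    apply/mnmP => u; rewrite !(mnmDE, mnmBE, mulmnE, mnm1E).
    by have := ltn_ord a; case: (eqVneq j u) => [<-|_]; lia.
  rewrite !(mnmDE, mnmBE, mulmnE, mnm1E) eqxx (negPf ne_ij).
  by have := ltn_ord a; lia.
rewrite big_ord_recl mulr0n add0r; apply: eq_bigr => a _.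
rewrite fderivE /g /msplit /bump /=; congr (f _ *+ _).
  apply/mnmP => u; rewrite !(mnmDE, mnmBE, mulmnE, mnm1E).
  by rewrite /bump leq0n; case: (eqVneq j u) => [<-|_]; case: (i == _); lia.
by rewrite /bump leq0n !(mnmDE, mnmBE, mulmnE, mnm1E) eqxx m0 eq_sym (negPf ne_ij); lia.
Qed.

End Substitution.

(** * Integrals with a variable upper bound *)

Section Integral.
Variables (n : nat) (i j : 'I_n).
Hypothesis ne_ij : i != j.
Implicit Types (f g h : mfps n) (m k : 'X_{1..n}).

Lemma fsubst_var_free f : fderiv i f = 0 -> fsubst_var i j f = f.
Proof.
move=> Df; apply: mfpsP => m; have [m0|m_i] := eqVneq (m i) 0%N; last first.
  by rewrite fsubst_var_neq0 // (mfps_free0 Df).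
rewrite fsubst_varE // big_ord_recl big1 ?addr0 => [|a _].
  by rewrite /msplit !mulm0n subm0 addm0.
by rewrite (mfps_free0 Df) // msplitE // eqxx.
Qed.

Lemma fsubst_var_var : fsubst_var i j (mfps_var i) = mfps_var j.
Proof.
apply: mfpsP => m; rewrite (fsubst_var_psubst ne_ij _ (ltnSn _)).
transitivity ((psubst i j 'X_i)@_m).
  apply: (psubst_low ne_ij) => k le_km.
  by rewrite mfps_trunc_low ?ltnS // mcoeffX /mfps_var eq_sym.
rewrite psubstX // mcoeffX /mfps_var eq_sym; congr (_ == _)%:R.
apply/mnmP => l; rewrite msubstE // !mnm1E eqxx [i == l]eq_sym [j == l]eq_sym.
case: (eqVneq l i) => [->|_]; first by rewrite (negPf ne_ij).
by case: (l == j); rewrite ?(negPf ne_ij).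
Qed.

Lemma fintD f g : fint i j (f + g) = fint i j f + fint i j g.
Proof. by rewrite /fint fprimD fsubst_varD. Qed.

Lemma fintN f : fint i j (- f) = - fint i j f.
Proof. by rewrite /fint fprimN fsubst_varN. Qed.

Lemma fint_fderiv f : (forall m, m i = 0%N -> f m = 0) ->
  fint i j (fderiv i f) = fsubst_var i j f.
Proof. by move=> f0; rewrite /fint (@fprim_unique _ _ f). Qed.

(** Leibniz' rule for a variable upper bound: the chain rule for the
    substitution produces the boundary term. *)
Lemma fderiv_fint f :
  fderiv j (fint i j f) = fsubst_var i j f + fint i j (fderiv j f).
Proof.
rewrite /fint fderiv_fsubst_var // fderiv_fprim (fprim_fderiv _ ne_ij).
by rewrite fsubst_varD addrC.
Qed.

Lemma fderiv_fint_other l f : l != i -> l != j ->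
  fderiv l (fint i j f) = fint i j (fderiv l f).
Proof.
move=> nli nlj; rewrite /fint fderiv_fsubst_var_other //.
by rewrite fprim_fderiv // eq_sym.
Qed.

Lemma fderiv_fint_bound f : fderiv i (fint i j f) = 0.
Proof.
apply: mfpsP => m; rewrite fderivE /fint fsubst_var_neq0 ?mul0rn //.
by rewrite mnmDE mnm1E eqxx addn1.
Qed.

Lemma fint_varM l f : l != i -> fint i j (mfps_var l * f) = mfps_var l * fint i j f.
Proof.
move=> nli; rewrite /fint fprim_varM 1?eq_sym // fsubst_varM //.
by rewrite fsubst_var_free // fderiv_var eq_sym (negPf nli).
Qed.

Lemma fint_upper0 f m : m j = 0%N -> fint i j f m = 0.
Proof.
move=> m_j; have [m_i|m_i] := eqVneq (m i) 0%N; last exact: fsubst_var_neq0.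
rewrite /fint fsubst_varE // m_j big_ord1 fprim0 //.
by rewrite msplitE // eqxx.
Qed.

(** When the integrand does not involve the upper bound, only the monomial
    whose whole degree in X_j comes from X_i contributes. *)
Lemma fint_freeE f m : fderiv j f = 0 -> m i = 0%N ->
  fint i j f m = fprim i f (msplit i j m (m j)).
Proof.
move=> Df m_i; rewrite /fint fsubst_varE // big_ord_recr /= big1 ?add0r // => a _.
have Dp : fderiv j (fprim i f) = 0.
  by rewrite -fprim_fderiv // Df; apply: fprim_unique; rewrite ?fderiv0.
rewrite (mfps_free0 Dp) // msplitE // eqxx [j == i]eq_sym (negPf ne_ij).
by have := ltn_ord a; lia.
Qed.
End Integral.

(** * Coefficients of exponentials *)

Section Exponential.
Variable n : nat.
Implicit Types (f g h : mfps n) (m k : 'X_{1..n}) (i : 'I_n).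

Lemma fexp_vanish i f m : (forall k, k i = 0%N -> f k = 0) -> m i = 0%N ->
  fexp f m = (1 : mfps n) m.
Proof.
move=> f0 m_i; rewrite /fexp /fexp_trunc mfps_sum big_ord_recl big1 => [|a _].
  by rewrite addr0 mfpsZ expr0 fact0 invr1 mul1r.
rewrite mfpsZ exprS; apply/eqP; rewrite mulf_eq0 orbC; apply/orP; left.
apply: contraTT isT => /mfpsM_neq0[k1 [k2 [def_m]]].
by rewrite f0 ?eqxx //; have := congr1 (fun u : 'X_{1..n} => u i) def_m; rewrite mnmDE; lia.
Qed.

Lemma fexp0 : fexp (0 : mfps n) = 1.
Proof.
apply: mfpsP => m; rewrite /fexp /fexp_trunc mfps_sum big_ord_recl big1 => [|a _].
  by rewrite addr0 mfpsZ expr0 fact0 invr1 mul1r.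
by rewrite mfpsZ exprS mul0r mulr0.
Qed.

Lemma mfps_varM_const i f : (mfps_var i * f) 0%MM = 0.
Proof. by rewrite mfps_varM mnm0E. Qed.

(** For f free of X_i, the degree in X_i of a monomial is the index of the
    only power of X_i f that contains it: truncating the exponential truncates
    in X_i. *)
Lemma fexp_trunc_varM i f d m : fderiv i f = 0 ->
  fexp_trunc d (mfps_var i * f) m =
    if (m i <= d)%N then fexp (mfps_var i * f) m else 0.
Proof.
move=> Df.
have term a : ((mfps_var i * f) ^+ a) m != 0 -> m i = a.
  by apply: mfps_var_exp_hom => k; apply: mfps_free0.
have truncE d' : fexp_trunc d' (mfps_var i * f) m =
    if (m i <= d')%N then ((m i)`!%:R)^-1 * ((mfps_var i * f) ^+ m i) m else 0.
  rewrite /fexp_trunc mfps_sum; case: leqP => [le_mi|lt_mi].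
    rewrite (bigD1 (Ordinal (le_mi : (m i < d'.+1)%N))) //= mfpsZ big1 ?addr0 // => a ne_a.
    rewrite mfpsZ; apply/eqP; rewrite mulf_eq0 orbC; apply/orP; left.
    by apply: contraNT ne_a => /term eq_a; apply/eqP/val_inj.
  rewrite big1 // => a _; rewrite mfpsZ; apply/eqP; rewrite mulf_eq0 orbC.
  by apply/orP; left; apply: contraTT (ltn_ord a) => /term; lia.
rewrite /fexp !truncE mdegE (bigD1 i) //= leq_addr.
by case: ifP.
Qed.
End Exponential.

(** * The differential equation *)

Lemma iyx : iy != ix. Proof. by rewrite -val_eqE /= !inordK. Qed.
Lemma irx : ir != ix. Proof. by rewrite -val_eqE /= !inordK. Qed.
Lemma itx : it != ix. Proof. by rewrite -val_eqE /= !inordK. Qed.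
Lemma iry : ir != iy. Proof. by rewrite -val_eqE /= !inordK. Qed.
Lemma ity : it != iy. Proof. by rewrite -val_eqE /= !inordK. Qed.
Lemma itr : it != ir. Proof. by rewrite -val_eqE /= !inordK. Qed.

Lemma var4_cases (l : 'I_4) : [\/ l = ix, l = iy, l = ir | l = it].
Proof.
by case: l => -[|[|[|[|]]]] // lt4; [apply: Or41|apply: Or42|apply: Or43|apply: Or44];
  apply: val_inj; rewrite /= inordK.
Qed.

Section Touchard.
Local Notation y := (mfps_var iy).
Local Notation r := (mfps_var ir).
Local Notation t := (mfps_var it).
Implicit Types (f g : mfps 4) (m : 'X_{1..4}).

(** This derivation kills y e^r, and f |-> rderiv f - y f acts on coefficients
    as the recurrence of the Stirling numbers (see [pde_coef]). *)
Definition rderiv f : mfps 4 := fderiv ir f - y * fderiv iy f.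

Lemma rderivD f g : rderiv (f + g) = rderiv f + rderiv g.
Proof. by rewrite /rderiv !fderivD; ring. Qed.
Lemma rderivN f : rderiv (- f) = - rderiv f.
Proof. by rewrite /rderiv !fderivN; ring. Qed.
Lemma rderivM f g : rderiv (f * g) = rderiv f * g + f * rderiv g.
Proof. by rewrite /rderiv !fderivM; ring. Qed.
Lemma rderiv_nat d : rderiv d%:R = 0.
Proof. by rewrite /rderiv !fderiv_nat; ring. Qed.
Lemma rderiv1 : rderiv 1 = 0.
Proof. exact: rderiv_nat 1%N. Qed.
Lemma rderiv_y : rderiv y = - y.
Proof. by rewrite /rderiv !fderiv_var (negPf iry) eqxx mulr1 sub0r. Qed.
Lemma rderiv_r : rderiv r = 1.
Proof. by rewrite /rderiv !fderiv_var [iy == _]eq_sym (negPf iry) eqxx mulr0 subr0. Qed.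
Lemma rderiv_t : rderiv t = 0.
Proof. by rewrite /rderiv !fderiv_var ![_ == it]eq_sym (negPf itr) (negPf ity) mulr0 subr0. Qed.
Lemma rderiv_fexp f : f 0%MM = 0 -> rderiv (fexp f) = rderiv f * fexp f.
Proof. by move=> f0; rewrite /rderiv !fderiv_fexp //; ring. Qed.
Lemma rderiv_fexp_trunc d f : rderiv f = 0 -> rderiv (fexp_trunc d f) = 0.
Proof.
case: d => [|d] Df.
  by rewrite /fexp_trunc big_ord1 expr0 fact0 invr1 scale1r rderiv1.
by rewrite /rderiv !fderiv_fexp_truncS mulrA -mulrBl -/(rderiv f) Df mul0r.
Qed.
Lemma mfps_var_const i : (mfps_var i : mfps 4) 0%MM = 0.
Proof. by rewrite /mfps_var eq_sym mnm1_eq0. Qed.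

Lemma fderiv_fexp_var i l :
  fderiv i (fexp (mfps_var l : mfps 4)) = (i == l)%:R * fexp (mfps_var l).
Proof. by rewrite fderiv_fexp ?mfps_var_const // fderiv_var. Qed.

Definition touchard_exponent : mfps 4 := y * (fexp r - 1).
(** The exponential generating function of the Touchard polynomials,
    \sum S(n,k) r^n/n! y^k. *)
Definition touchard : mfps 4 := fexp touchard_exponent.

Lemma rderiv_fexp_r : rderiv (fexp r) = fexp r.
Proof. by rewrite rderiv_fexp ?mfps_var_const // rderiv_r mul1r. Qed.

Lemma touchard_exponent_const : touchard_exponent 0%MM = 0.
Proof. exact: mfps_varM_const. Qed.

Lemma rderiv_touchard_exponent : rderiv touchard_exponent = y.
Proof. by rewrite rderivM rderivD rderivN rderiv1 rderiv_y rderiv_fexp_r; ring. Qed.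

Lemma rderiv_touchard : rderiv touchard = y * touchard.
Proof.
by rewrite rderiv_fexp ?touchard_exponent_const // rderiv_touchard_exponent.
Qed.

Lemma fderiv_touchard_exponent : fderiv ir touchard_exponent = y * fexp r.
Proof.
rewrite fderivM fderivD fderivN fderiv1 fderiv_var fderiv_fexp_var (negPf iry) eqxx.
by rewrite -[true%:R]/(1 : mfps 4) -[false%:R]/(0 : mfps 4); ring.
Qed.

Lemma fderiv_touchard : fderiv ir touchard = y * fexp r * touchard.
Proof.
by rewrite fderiv_fexp ?touchard_exponent_const // fderiv_touchard_exponent.
Qed.

Definition integrand (s : nat) : mfps 4 :=
  fexp (y * (fexp (r - t) - 1)) *
    (y * fexp r * fexp_trunc (s - 1)%N ((fexp t - 1) * fexp (r - t) * y)
     - s%:R * fexp_trunc s ((fexp t - 1) * fexp (r - t) * y)).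

(** The arguments of the truncated exponentials equal y e^r - y e^(r-t), and
    rderiv kills both terms. *)
Lemma rderiv_integrand s : rderiv (integrand s) = y * integrand s.
Proof.
have rt0 : (r - t) 0%MM = 0 by rewrite mfpsD mfpsN !mfps_var_const subr0.
have Drt : rderiv (fexp (r - t)) = fexp (r - t).
  by rewrite rderiv_fexp // rderivD rderivN rderiv_r rderiv_t; ring.
have DF : rderiv (fexp (y * (fexp (r - t) - 1))) = y * fexp (y * (fexp (r - t) - 1)).
  rewrite rderiv_fexp ?mfps_varM_const // rderivM rderivD rderivN rderiv1 rderiv_y Drt.
  by ring.
have Du : rderiv ((fexp t - 1) * fexp (r - t) * y) = 0.
  rewrite !rderivM rderivD rderivN rderiv1 rderiv_fexp ?mfps_var_const //.
  by rewrite rderiv_t rderiv_y Drt; ring.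
rewrite /integrand rderivM DF rderivD rderivN !rderivM rderiv_y rderiv_fexp_r rderiv_nat.
by rewrite !rderiv_fexp_trunc //; ring.
Qed.

Lemma fsubst_integrand s :
  fsubst_var it ir (integrand s) =
    y * fexp r * fexp_trunc (s - 1)%N touchard_exponent
    - s%:R * fexp_trunc s touchard_exponent.
Proof.
have sV l : l != it -> fsubst_var it ir (mfps_var l) = mfps_var l :> mfps 4.
  by move=> nl; rewrite fsubst_var_free ?itr // fderiv_var eq_sym (negPf nl).
have sr : fsubst_var it ir r = r by apply: sV; rewrite eq_sym itr.
have sy : fsubst_var it ir y = y by apply: sV; rewrite eq_sym ity.
have s1 := fsubst_var1 itr.
have sE : fsubst_var it ir (fexp (r - t)) = 1.
  rewrite fsubst_var_fexp ?itr // fsubst_varD fsubst_varN sr fsubst_var_var ?itr //.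
  by rewrite subrr fexp0.
have sF : fsubst_var it ir (fexp (y * (fexp (r - t) - 1))) = 1.
  rewrite fsubst_var_fexp ?itr // fsubst_varM ?itr // fsubst_varD fsubst_varN.
  by rewrite sy sE s1 subrr mulr0 fexp0.
have su : fsubst_var it ir ((fexp t - 1) * fexp (r - t) * y) = touchard_exponent.
  rewrite !fsubst_varM ?itr // fsubst_varD fsubst_varN sE sy s1.
  rewrite fsubst_var_fexp ?itr // fsubst_var_var ?itr // /touchard_exponent; ring.
rewrite /integrand !fsubst_varM ?itr // sF mul1r fsubst_varD fsubst_varN !fsubst_varM ?itr //.
rewrite sy fsubst_var_fexp ?itr // sr fsubst_var_nat ?itr //.
by rewrite !fsubst_var_fexp_trunc ?itr // su.
Qed.

(** The right-hand side of the theorem is the integral of this series from 0 to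
    x: the first term is the derivative of r exp(y (e^r - 1)), whose integral
    is x exp(y (e^x - 1)). *)
Definition Phi (s : nat) : mfps 4 :=
  fderiv ir (r * touchard) - (1 + s%:R * r) * touchard - fint it ir (integrand s).

Definition touchard_tail (s : nat) : mfps 4 :=
  touchard - fexp_trunc s touchard_exponent.

(** By [rderiv_integrand], the inner integral contributes only through its
    boundary term at t = r. *)
Lemma Phi_pde s : (0 < s)%N ->
  rderiv (Phi s) - y * Phi s = fderiv ir (touchard_tail s) - s%:R * touchard_tail s.
Proof.
case: s => // s _.
have DJ : rderiv (fint it ir (integrand s.+1)) =
    fsubst_var it ir (integrand s.+1) + y * fint it ir (integrand s.+1).
  have nyt : iy != it by rewrite eq_sym ity.
  rewrite {1}/rderiv (fderiv_fint itr) (fderiv_fint_other itr) // 1?eq_sym ?iry //.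
  rewrite -!(fint_varM itr) // -addrA -fintN -fintD; congr (_ + fint _ _ _).
  by rewrite -/(rderiv _) rderiv_integrand.
have DrB : fderiv ir (r * touchard) = touchard + r * (y * fexp r * touchard).
  by rewrite fderivM fderiv_var eqxx fderiv_touchard mul1r.
have -> : Phi s.+1 = r * (y * fexp r * touchard) - s.+1%:R * r * touchard
    - fint it ir (integrand s.+1).
  by rewrite /Phi DrB; ring.
rewrite !rderivD !rderivN DJ fsubst_integrand !rderivM rderiv_r rderiv_y rderiv_fexp_r.
rewrite rderiv_touchard rderiv_nat /touchard_tail fderivD fderivN fderiv_touchard.
rewrite fderiv_fexp_truncS fderiv_touchard_exponent subn1 /=; ring.
Qed.

(** The terms free of the factor r cancel: D_r(r E) - E = r D_r E. *)
Lemma Phi_vanish s m : m ir = 0%N -> Phi s m = 0.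
Proof.
move=> m_r; rewrite /Phi fderivM fderiv_var eqxx.
have -> : 1%:R * touchard + r * fderiv ir touchard - (1 + s%:R * r) * touchard
    = r * (fderiv ir touchard - s%:R * touchard) by ring.
by rewrite mfpsD mfpsN (fint_upper0 itr) // mfps_varM m_r subr0.
Qed.

Lemma fderiv_touchard_exponent_other i : i != ir -> i != iy ->
  fderiv i touchard_exponent = 0.
Proof.
move=> nir niy.
rewrite fderivM fderivD fderivN fderiv1 fderiv_var fderiv_fexp_var (negPf nir) (negPf niy).
by rewrite -[false%:R]/(0 : mfps 4); ring.
Qed.

Lemma fderiv_touchard_other i : i != ir -> i != iy -> fderiv i touchard = 0.
Proof.
move=> nir niy; rewrite fderiv_fexp ?touchard_exponent_const //.
by rewrite fderiv_touchard_exponent_other ?mul0r.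
Qed.

Lemma Phi_free_x s : fderiv ix (Phi s) = 0.
Proof.
have nxr : ix != ir by rewrite eq_sym irx.
have nxy : ix != iy by rewrite eq_sym iyx.
have nxt : ix != it by rewrite eq_sym itx.
have DB := fderiv_touchard_other nxr nxy.
have rt0 : (r - t) 0%MM = 0 by rewrite mfpsD mfpsN !mfps_var_const subr0.
have Dv l : ix != l -> fderiv ix (mfps_var l) = 0 :> mfps 4.
  by move=> nl; rewrite fderiv_var (negPf nl).
have De l : ix != l -> fderiv ix (fexp (mfps_var l)) = 0 :> mfps 4.
  by move=> nl; rewrite fderiv_fexp_var (negPf nl) mul0r.
have Dert : fderiv ix (fexp (r - t)) = 0.
  by rewrite fderiv_fexp // fderivD fderivN !Dv // subr0 mul0r.
have DF : fderiv ix (fexp (y * (fexp (r - t) - 1))) = 0.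
  rewrite fderiv_fexp ?mfps_varM_const // fderivM fderivD fderivN Dert fderiv1 Dv //.
  by ring.
have Dtr d f : fderiv ix f = 0 -> fderiv ix (fexp_trunc d f) = 0.
  move=> Df; case: d => [|d]; last by rewrite fderiv_fexp_truncS Df mul0r.
  by rewrite /fexp_trunc big_ord1 fderivZ expr0 fderiv1 scaler0.
have Du : fderiv ix ((fexp t - 1) * fexp (r - t) * y) = 0.
  by rewrite !fderivM fderivD fderivN fderiv1 De // Dert Dv //; ring.
have DI : fderiv ix (integrand s) = 0.
  rewrite /integrand fderivM DF fderivD fderivN !fderivM !Dtr // Dv // De // fderiv_nat.
  by ring.
have int0 : fint it ir (0 : mfps 4) = 0.
  by apply: (addrI (fint it ir 0)); rewrite -fintD !addr0.
rewrite /Phi !(fderivD, fderivN) (fderiv_fint_other itr) // DI int0 fderivC.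
rewrite !(fderivM, fderivD) DB fderiv1 Dv // fderiv_nat !mul0r !mulr0 !addr0 fderiv0; ring.
Qed.

Lemma Phi_free_t s : fderiv it (Phi s) = 0.
Proof.
have DB := fderiv_touchard_other itr ity.
rewrite /Phi !(fderivD, fderivN) fderiv_fint_bound fderivC.
have Dr : fderiv it r = 0 by rewrite fderiv_var (negPf itr).
rewrite !(fderivM, fderivD) DB Dr fderiv1 fderiv_nat.
by rewrite !mul0r !mulr0 !addr0 fderiv0; ring.
Qed.

(** * Comparison of coefficients *)

Definition mon (n k : nat) : 'X_{1..4} := (U_(ir) *+ n + U_(iy) *+ k)%MM.

Lemma mon_r n k : mon n k ir = n.
Proof. by rewrite mnmDE !mulmnE !mnm1E eqxx [iy == _]eq_sym (negPf iry); lia. Qed.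
Lemma mon_y n k : mon n k iy = k.
Proof. by rewrite mnmDE !mulmnE !mnm1E eqxx (negPf iry); lia. Qed.

Lemma mon_Sr n k : mon n.+1 k = (mon n k + U_(ir))%MM.
Proof. by apply/mnmP => l; rewrite !(mnmDE, mulmnE) mulnS; lia. Qed.
Lemma mon_Sy n k : mon n k.+1 = (mon n k + U_(iy))%MM.
Proof. by apply/mnmP => l; rewrite !(mnmDE, mulmnE) mulnS; lia. Qed.

Lemma pde_coef f n k :
  (rderiv f - y * f) (mon n k) =
  n.+1%:R * f (mon n.+1 k) - k%:R * f (mon n k)
    - (0 < k)%:R * f (mon n k.-1).
Proof.
rewrite /rderiv !(mfpsD, mfpsN) !mfps_varM !fderivE mon_r mon_y.
rewrite -mon_Sr.
rewrite mulr_natl; case: k => [|k] /=; first by rewrite !mul0r.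
have -> : (mon n k.+1 - U_(iy))%MM = mon n k by rewrite mon_Sy addmK.
by rewrite -mon_Sy mon_y !mulr_natl mulr1n.
Qed.

Lemma touchard_coef n k : touchard (mon n k) * n`!%:R = (size (rgf n k))%:R.
Proof.
elim: n k => [|n IHn] k.
  rewrite fact0 mulr1 /touchard (@fexp_vanish _ ir) ?mon_r //.
    rewrite mfps1 /mon mulm0n add0m -mdeg_eq0 mdegMn mdeg1 mul1n.
    by case: k.
  move=> m m_r; rewrite /touchard_exponent mfps_varM; case: ifP => // _.
  rewrite mfpsD mfpsN (@fexp_vanish _ ir) ?subrr //; last first.
    by rewrite mnmBE m_r.
  by move=> u; rewrite /mfps_var; case: eqP => // ->; rewrite mnm1E eqxx.
(* The exponential satisfies the homogeneous equation. *)
have := pde_coef touchard n k; rewrite rderiv_touchard subrr mfps0 => /esym/eqP.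
rewrite -addrA -opprD subr_eq0 => /eqP eqB.
rewrite factS natrM mulrA [X in X * _]mulrC eqB mulrDl -mulrA IHn.
case: k {eqB} => [|k]; first by rewrite !mul0r addr0.
by rewrite /= mul1r IHn size_rgfS natrD natrM.
Qed.

Lemma touchard_tail_coef s n k :
  touchard_tail s (mon n k) = if (k <= s)%N then 0 else touchard (mon n k).
Proof.
have DV : fderiv iy (fexp r - 1) = 0.
  by rewrite fderivD fderivN fderiv1 fderiv_fexp_var eq_sym (negPf iry) mul0r subr0.
rewrite /touchard_tail mfpsD mfpsN /touchard_exponent (fexp_trunc_varM _ _ DV) mon_y.
by case: ifP; rewrite ?subrr ?subr0.
Qed.

(** On coefficients, [Phi_pde] is the recurrence [rgf_occ_rec] divided by n!. *)
Lemma Phi_coef s n k : (2 <= s)%N ->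
  Phi s (mon n k) * n`!%:R = (rgf_occ s n.+1 k)%:R.
Proof.
move=> s_ge2; have s_gt0 : (0 < s)%N by apply: ltnW.
elim: n k => [|n IHn] k; first by rewrite Phi_vanish ?mon_r // rgf_occ1 mul0r.
have := pde_coef (Phi s) n k; rewrite Phi_pde //.
rewrite mfpsD mfpsN fderivE mfps_natmul mon_r.
rewrite -mon_Sr.
rewrite !touchard_tail_coef => eqPhi.
have {eqPhi} eqPhi : n.+1%:R * Phi s (mon n.+1 k) =
   k%:R * Phi s (mon n k) + (0 < k)%:R * Phi s (mon n k.-1)
   + ((if (k <= s)%N then 0 else touchard (mon n.+1 k)) *+ n.+1
   - s%:R * (if (k <= s)%N then 0 else touchard (mon n k))).
  by rewrite eqPhi; ring.
rewrite factS natrM mulrA [X in X * _]mulrC eqPhi.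
case: k {eqPhi} => [|k].
  by rewrite leq0n /rgf_occ big_nil mul0rn mulr0 subrr ltnn !mul0r ?addr0 ?mul0r.
have := congr1 (fun a : nat => a%:R : rat) (rgf_occ_rec s_ge2 n k).
rewrite !(natrD, natrM) -!IHn -!touchard_coef factS natrM ltnS => eqp.
have -> : (rgf_occ s n.+2 k.+1)%:R =
   k.+1%:R * (Phi s (mon n k.+1) * n`!%:R) + Phi s (mon n k) * n`!%:R
   + (s <= k)%:R * (touchard (mon n.+1 k.+1) * (n.+1%:R * n`!%:R))
   - s%:R * (s <= k)%:R * (touchard (mon n k.+1) * n`!%:R) :> rat.
  by rewrite -eqp; ring.
by rewrite /= mul1r; case: leqP => _ /=; rewrite -mulr_natl; ring.
Qed.
End Touchard.

Theorem theorem4p3 (s : nat) (hs : (2 <= s)%N) :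
  let x := mfps_var ix in
  let y := mfps_var iy in
  let r := mfps_var ir in
  let t := mfps_var it in
  Qseries s =
    x * fexp (y * (fexp x - 1))
    - fint ir ix ((1 + s%:R * r) * fexp (y * (fexp r - 1)))
    - fint ir ix (fint it ir
        (fexp (y * (fexp (r - t) - 1)) *
         (y * fexp r * fexp_trunc (s - 1)%N ((fexp t - 1) * fexp (r - t) * y)
          - s%:R * fexp_trunc s ((fexp t - 1) * fexp (r - t) * y)))).
Proof.
move=> x y r t.
have -> : x * fexp (y * (fexp x - 1)) = fint ir ix (fderiv ir (r * touchard)).
  rewrite fint_fderiv => [|m m_r]; last by rewrite mfps_varM m_r.
  rewrite fsubst_varM ?irx // fsubst_var_var ?irx // /touchard /touchard_exponent.
  rewrite fsubst_var_fexp ?irx //.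
  rewrite fsubst_varM ?irx // fsubst_varD fsubst_varN fsubst_var1 ?irx //.
  rewrite fsubst_var_fexp ?irx // fsubst_var_var ?irx // fsubst_var_free ?irx //.
  by rewrite fderiv_var (negPf iry).
transitivity (fint ir ix (Phi s)); last by rewrite /Phi !fintD !fintN.
apply: mfpsP => m; rewrite /Qseries.
have [m_r|m_r] := eqVneq (m ir) 0%N; last first.
  by rewrite andbF /fint fsubst_var_neq0.
rewrite (fint_freeE irx) ?Phi_free_x // total_occurrencesE.
have split_r a : msplit ir ix m a ir = a by rewrite msplitE ?irx // eqxx.
case m_x: (m ix) => [|n]; first by rewrite fprim0 // rgf_occ0 mul0r if_same.
rewrite /fprim split_r /=.
have [m_t|m_t] := eqVneq (m it) 0%N; last first.
  rewrite andbF (mfps_free0 (Phi_free_t s)) ?mul0r //.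
  rewrite mnmBE msplitE ?irx // mnm1E (negPf itr) (negPf itx).
  by rewrite [ir == it]eq_sym (negPf itr) subn0.
have -> : (msplit ir ix m n.+1 - U_(ir))%MM = mon n (m iy).
  apply/mnmP => l; case: (var4_cases l) => ->;
    rewrite ?mon_r ?mon_y mnmBE msplitE ?irx // mnm1E.
  - rewrite m_x [ix == _]eq_sym (negPf irx) eqxx /mon mnmDE.
    by rewrite !mulmnE !mnm1E (negPf irx) (negPf iyx); lia.
  - by rewrite [iy == ir]eq_sym (negPf iry) (negPf iyx); lia.
  - by rewrite eqxx; lia.
  by rewrite [ir == it]eq_sym (negPf itr) (negPf itx) /mon mnmDE !mulmnE !mnm1E
    [ir == it]eq_sym (negPf itr) [iy == it]eq_sym (negPf ity); lia.
rewrite andbT.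
have -> : (if (s < m iy)%N then (rgf_occ s n.+1 (m iy))%:R / (n.+1`!)%:R else 0)
    = (rgf_occ s n.+1 (m iy))%:R / (n.+1`!)%:R :> rat.
  by case: ltnP => // le_ks; rewrite rgf_occ_small // mul0r.
rewrite -Phi_coef // factS natrM invfM [n.+1%:R^-1 * _]mulrC mulrA mulfK //.
by rewrite pnatr_eq0 -lt0n fact_gt0.
Qed.
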